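(* Let $\lambda$ be a partition of $n$. There exists an orthogonal basis $\{v_T\}$ of $V^\lambda$ (with respect to an $S_n$-invariant inner product), indexed by the standard Young tableaux $T$ of shape $\lambda$, in which the Coxeter generators $s_i=(i\ \,i+1)$, $i=1,\dots,n-1$, act as follows. Let $(a_1,\dots,a_n)$ be the contents of the boxes of $T$ ($a_j$ is the content of the box containing $j$). (i) If $i$ and $i+1$ are in the same row of $T$, then $s_iv_T=v_T$; if they are in the same column, then $s_iv_T=-v_T$. (ii) If $i$ and $i+1$ are in different rows and columns of $T$, let $T'$ be the standard tableau obtained from $T$ by exchanging $i$ and $i+1$. Then $s_i$ preserves the span of $v_T,v_{T'}$ and acts in the basis $(v_T,v_{T'})$ by the matrix $$s_i=\begin{pmatrix} r^{-1}&\sqrt{1-r^{-2}}\\ \sqrt{1-r^{-2}}&-r^{-1}\end{pmatrix},\qquad r=a_{i+1}-a_i .$$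
   Context: Representations are over $\mathbb{C}$. The content of a box is its column index minus its row index. For a partition $\lambda$ of $n$, $V^\lambda$ denotes the irreducible $S_n$-module having a basis $\{v_T\}$ indexed by standard Young tableaux $T$ of shape $\lambda$ consisting of common eigenvectors of $X_i=(1\,i)+\dots+(i-1\ i)$ ($i=1,\dots,n$), with $X_iv_T=c_iv_T$, where $c_i$ is the content of the box of $T$ containing $i$. (This characterizes $V^\lambda$, and every irreducible $S_n$-module is isomorphic to $V^\lambda$ for a unique $\lambda$.) *)

(* Defs.v *)
From HB Require Import structures.
From mathcomp Require Import all_boot all_order all_fingroup all_algebra.
From mathcomp Require Import sesquilinear mxrepresentation.
From mathcomp Require Import complex reals.

Set Implicit Arguments.
Unset Strict Implicit.
Unset Printing Implicit Defensive.
Import Order.TTheory GRing.Theory Num.Theory Num.Def.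
Local Open Scope ring_scope.

Definition is_partition (n : nat) (lam : seq nat) : bool :=
  [&& sorted geq lam, 0%N \notin lam & sumn lam == n].

(* The boxes of the Young diagram of lam; rows and columns are numbered
   from 0. *)
Definition box (lam : seq nat) : finType :=
  {r : 'I_(size lam) & 'I_(nth 0%N lam r)}.

Definition row_of (lam : seq nat) (b : box lam) : nat := tag b.
Definition col_of (lam : seq nat) (b : box lam) : nat := tagged b.

Definition content (lam : seq nat) (b : box lam) : int :=
  (col_of b)%:Z - (row_of b)%:Z.

(* The entries 1, ..., n of a tableau, and likewise the points permuted by S_n,
   are represented by 0, ..., n - 1 : 'I_n. *)
Definition is_standard (n : nat) (lam : seq nat)
    (T : {ffun box lam -> 'I_n}) : bool :=
  [&& injectiveb T,
      [forall j, j \in codom T],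
      [forall b, forall b',
         (row_of b == row_of b') && (col_of b < col_of b')%N ==>
         (T b < T b')%N]
    & [forall b, forall b',
         (col_of b == col_of b') && (row_of b < row_of b')%N ==>
         (T b < T b')%N]].

Record syt (n : nat) (lam : seq nat) : Type := Syt {
  filling :> {ffun box lam -> 'I_n};
  _ : is_standard filling
}.

HB.instance Definition _ n lam := [isSub for @filling n lam].
HB.instance Definition _ n lam := [Finite of syt n lam by <:].

Section Modules.
Variables (F : fieldType) (n d : nat).
(* The module is 'rV[F]_d, on which g acts by v |-> v *m rG g. MathComp's
   product g * h in 'S_n applies g first, so this right action is a left action
   for the usual composition of permutations. *)
Variable rG : mx_representation F [set: 'S_n]%G d.

Definition jucys_murphy (i : 'I_n) : 'M[F]_d :=
  \sum_(k < n | (k < i)%N) rG (tperm k i).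

Definition is_basis (I : finType) (v : I -> 'rV[F]_d) : bool :=
  basis_of fullv (codom v).

(* The module afforded by rG is (isomorphic to) V^lam. *)
Definition is_irr_module (lam : seq nat) : Prop :=
  mx_irreducible rG /\
  exists v : syt n lam -> 'rV[F]_d,
    is_basis v /\
    forall (T : syt n lam) (b : box lam),
      v T *m jucys_murphy (T b) = (content b)%:~R *: v T.

End Modules.

Definition invariant_form (R : realType) (n d : nat)
    (rG : mx_representation R[i] [set: 'S_n]%G d)
    (B : {dot 'rV[R[i]]_d for conjC}) : Prop :=
  forall (g : 'S_n) (u w : 'rV[R[i]]_d), B (u *m rG g) (w *m rG g) = B u w.

(* Main.v *)
(* After averaging an inner product over S_n, the Jucys-Murphy elements X_j are
   self-adjoint, so the given eigenbasis, whose content vectors are pairwise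
   distinct, is orthogonal; normalize it to (f_T). Write s = (i i+1). The relations
   s X_i = X_(i+1) s - 1 and s X_j = X_j s (j <> i, i+1) force
   <f_T s, f_T> = 1/r and <f_T s, f_R> = 0 unless R is T or sT, and Parseval's
   identity gives |<f_T s, f_(sT)>|^2 = 1 - 1/r^2. This yields Young's form up to
   the phases of the f_T.
   To fix the phases, choose a tableau T0 and write T = g_T T0 with g_T in S_n.
   By induction on the number of inversions, f_T0 g_T only involves f_T and f_R with
   g_R having fewer inversions than g_T, and its coefficient q_T on f_T satisfies
   q_(sT) = <f_T s, f_(sT)> q_T when the number of inversions goes up. Thus q_T is
   never 0, and all <e_T s, e_(sT)> are positive for e_T = (q_T / |q_T|) f_T. *)

Require Import Defs.
From HB Require Import structures.
From mathcomp Require Import all_boot all_order all_fingroup all_algebra.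
From mathcomp Require Import sesquilinear mxrepresentation.
From mathcomp Require Import complex reals zify ring.

Set Implicit Arguments.
Unset Strict Implicit.
Unset Printing Implicit Defensive.
Import Order.TTheory GRing.Theory Num.Theory Num.Def.
Local Open Scope ring_scope.

(** * Inversions of permutations and adjacent transpositions *)

Section Inversions.
Variable n : nat.
Implicit Types (s : 'S_n) (i : 'I_n).

(** Nothing lies strictly between [i] and [i'], so exchanging them can reverse only their own
    order. *)
Lemma tperm_succ_lt (i i' x y : 'I_n) : i' = i.+1 :> nat -> (x < y)%N ->
  (x, y) != (i, i') -> (tperm i i' x < tperm i i' y)%N.
Proof.
move=> i'E; rewrite xpair_eqE negb_and -!val_eqE /=.
by case: (tpermP i i' x) => [->|->|/eqP+ /eqP+];
  case: (tpermP i i' y) => [->|->|/eqP+ /eqP+]; rewrite -?val_eqE /= i'E; lia.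
Qed.

Definition inversions s : {set 'I_n * 'I_n} :=
  [set p : 'I_n * 'I_n | (p.1 < p.2)%N && (s p.2 < s p.1)%N].

(** The product applies [s] first, so the transposition exchanges the values [i] and [i']. The only
    pair whose status changes is the pair of positions of these two values, which becomes an
    inversion. *)
Lemma card_inversions_tperm s i i' : i' = i.+1 :> nat -> (s^-1%g i < s^-1%g i')%N ->
  #|inversions (s * tperm i i')%g| = #|inversions s|.+1.
Proof.
move=> i'E lt_ii'.
have -> : inversions (s * tperm i i')%g =
          (s^-1%g i, s^-1%g i') |: inversions s.
  apply/setP => -[x y]; rewrite !inE !permM /=.
  have [[sx sy]|not_ii'] := eqVneq (s x, s y) (i, i').
    have [-> ->] : x = s^-1%g i /\ y = s^-1%g i' by rewrite -sx -sy !permK.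
    by rewrite eqxx lt_ii' !permKV tpermL tpermR i'E leqnn.
  rewrite xpair_eqE -!(inj_eq (@perm_inj _ s) _ (s^-1%g _)) !permKV -xpair_eqE.
  rewrite (negPf not_ii') /=.
  have [[sx sy]|not_i'i] := eqVneq (s y, s x) (i, i').
    have [-> ->] : y = s^-1%g i /\ x = s^-1%g i' by rewrite -sx -sy !permK.
    by rewrite [(_ < _)%N]ltnNge ltnW.
  congr (_ && _); case: (ltngtP (s y) (s x)) => [lt_yx|lt_xy|/val_inj->].
  - by rewrite tperm_succ_lt.
  - by rewrite ltnNge ltnW // tperm_succ_lt.
  - by rewrite ltnn.
by rewrite cardsU1 inE /= !permKV lt_ii' /= i'E ltnNge leqnSn.
Qed.

(** If the inverse had no descent, its list of values would be a sorted rearrangement of 0, ..., n -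
    1, which forces the identity. *)
Lemma exists_descent s : s != 1%g ->
  exists i i', i' = i.+1 :> nat /\ (s^-1%g i' < s^-1%g i)%N.
Proof.
move=> s_neq1; pose t := (s^-1)%g.
have [/existsP[i /existsP[i' /andP[/eqP i'E lt_ii']]]|/existsPn no_desc] :=
  boolP [exists i : 'I_n, exists i' : 'I_n, (i' == i.+1 :> nat) && (t i' < t i)%N].
  by exists i, i'.
case/eqP: s_neq1; apply: invg_inj; rewrite invg1 -/t.
have asc (i i' : 'I_n) : i' = i.+1 :> nat -> (t i < t i')%N.
  move=> i'E; have /existsPn/(_ i') := no_desc i; rewrite i'E eqxx -leqNgt.
  rewrite leq_eqVlt => /predU1P[/val_inj/perm_inj eq_ii'|//].
  by move: i'E; rewrite eq_ii' => /n_Sn.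
have nth_t (j : 'I_n) : nth 0%N (map (val \o t) (enum 'I_n)) j = t j.
  by rewrite (nth_map j) ?size_enum_ord // nth_ord_enum.
have t_iota : map (val \o t) (enum 'I_n) = map val (enum 'I_n).
  apply: (irr_sorted_eq ltn_trans ltnn).
  - apply/(sortedP 0%N) => k; rewrite size_map size_enum_ord => lt_k.
    pose k0 : 'I_n := Ordinal (ltnW lt_k); pose k1 := Ordinal lt_k.
    by have := asc k0 k1 erefl; rewrite -!nth_t.
  - by rewrite val_enum_ord iota_ltn_sorted.
  - move=> k; apply/mapP/mapP => -[x _ ->] /=.
      by exists (t x); rewrite ?mem_enum.
    by exists (s x); rewrite ?mem_enum //= permK.
apply/permP => i; rewrite perm1; apply: val_inj.
by rewrite /= -nth_t t_iota val_enum_ord nth_iota.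
Qed.

End Inversions.

(** * Boxes of a Young diagram *)

Section Boxes.
Variable lam : seq nat.
Implicit Types b c : box lam.

Lemma box_eq b c : row_of b = row_of c -> col_of b = col_of c -> b = c.
Proof.
case: b c => [r x] [r' x'] /ord_inj/= rr'; case: _ / rr' x' => x'.
by move=> xx'; congr existT; apply: val_inj.
Qed.

Lemma box_content_eq b c :
  row_of b = row_of c -> content b = content c -> b = c.
Proof. by move=> rbc; rewrite /content => cbc; apply: box_eq => //; lia. Qed.

(** Row lengths weakly decrease, so the diagram is closed under moving up and to the left. *)
Lemma box_above n c r x : is_partition n lam ->
    (r <= row_of c)%N -> (x <= col_of c)%N ->
  exists b, row_of b = r /\ col_of b = x.
Proof.
case/and3P=> lam_dec _ _; case: c => r' x'; rewrite /row_of /col_of /= => rr' xx'.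
have r_lt : (r < size lam)%N by apply: leq_ltn_trans rr' _.
have x_lt : (x < nth 0%N lam (Ordinal r_lt))%N.
  apply: leq_ltn_trans xx' _; apply: leq_trans (ltn_ord x') _ => /=.
  have geq_tr : transitive geq by move=> ? ? ? h1 h2; apply: leq_trans h2 h1.
  have := sorted_leq_nth geq_tr leqnn 0%N lam_dec r r' r_lt (ltn_ord r') rr'.
  exact.
by exists (Tagged (fun r : 'I_(size lam) => 'I_(nth 0%N lam r)) (Ordinal x_lt)).
Qed.

End Boxes.

(** * Standard tableaux and their content vectors *)

Section Tableaux.
Variables (n : nat) (lam : seq nat).
Implicit Types (T R : syt n lam) (b c : box lam) (i j : 'I_n).

Lemma syt_inj T : injective T.
Proof. by case: T => T /= /and4P[/injectiveP]. Qed.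

Lemma syt_codom T j : j \in codom T.
Proof. by case: T => T /= /and4P[_ /forallP]. Qed.

Lemma syt_row_lt T b c :
  row_of b = row_of c -> (col_of b < col_of c)%N -> (T b < T c)%N.
Proof.
case: T => T /= /and4P[_ _ /forallP/(_ b)/forallP/(_ c) + _] rbc cbc.
by rewrite rbc eqxx cbc.
Qed.

Lemma syt_col_lt T b c :
  col_of b = col_of c -> (row_of b < row_of c)%N -> (T b < T c)%N.
Proof.
case: T => T /= /and4P[_ _ _ /forallP/(_ b)/forallP/(_ c)] + cbc rbc.
by rewrite cbc eqxx rbc.
Qed.

Definition box_at T j : box lam := iinv (syt_codom T j).

Lemma box_atK T : cancel (box_at T) T.
Proof. by move=> j; apply: f_iinv. Qed.

Lemma sytK T : cancel T (box_at T).
Proof. by move=> b; apply: (@syt_inj T); rewrite box_atK. Qed.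

Lemma syt_perm_subproof T R : injective (T \o box_at R).
Proof. exact: inj_comp (@syt_inj T) (can_inj (box_atK R)). Qed.

(** For a reference tableau [R], this is the permutation g with T = g R. *)
Definition syt_perm T R : 'S_n := perm (@syt_perm_subproof T R).

Lemma syt_permE T R b : syt_perm T R (R b) = T b.
Proof. by rewrite permE /= sytK. Qed.

(** Descents of the inverse can thus be read off in [R], by comparing the boxes that hold i and i +
    1 in [T]. *)
Lemma syt_permV T R j : (syt_perm T R)^-1%g j = R (box_at T j).
Proof. by apply: (canLR (permK _)); rewrite syt_permE box_atK. Qed.

Lemma syt_perm_id T : syt_perm T T = 1%g.
Proof. by apply/permP => j; rewrite perm1 permE /= box_atK. Qed.

Lemma syt_perm_inj R : injective (syt_perm^~ R).
Proof.
move=> T T' eqTT'; apply/val_inj/ffunP => b /=.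
by rewrite -(syt_permE T R) [syt_perm T R]eqTT' syt_permE.
Qed.

Lemma syt_perm_mul T T' R (g : 'S_n) : (forall b, T' b = g (T b)) ->
  syt_perm T' R = (syt_perm T R * g)%g.
Proof. by move=> T'E; apply/permP => j; rewrite permM !permE /= T'E. Qed.

(* Two fillings with the same content vector agree: on a diagonal the order of
   the entries is forced. *)
Lemma filling_content_inj (G H : box lam -> 'I_n) (G' H' : 'I_n -> box lam) :
    cancel G G' -> cancel G' G -> cancel H H' -> cancel H' H ->
    (forall b c, content b = content c -> (row_of b < row_of c)%N ->
      (G b < G c)%N && (H b < H c)%N) ->
    (forall j, content (G' j) = content (H' j)) -> G' =1 H'.
Proof.
move=> GK G'K HK H'K GHlt ctGH j.
have [m] := ubnP (val j); elim: m j => // m IHm j; rewrite ltnS => jm.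
have IHj (k : 'I_n) : (k < j)%N -> G' k = H' k.
  by move=> kj; apply: IHm; apply: leq_trans kj jm.
(* If the rows differ, the upper box has an entry k < j in the other filling. By induction the
   fillings agree at k, so the upper box holds both k and j in a single filling, which is absurd. *)
case: (ltngtP (row_of (G' j)) (row_of (H' j))) => [lt_GH|lt_HG|].
- have /andP[_] := GHlt _ _ (ctGH j) lt_GH; rewrite H'K => lt_j.
  have := IHj _ lt_j; rewrite HK => /(can_inj G'K) eq_j.
  by rewrite eq_j ltnn in lt_j.
- have /andP[+ _] := GHlt _ _ (esym (ctGH j)) lt_HG; rewrite G'K => lt_j.
  have := IHj _ lt_j; rewrite GK => /esym/(can_inj H'K) eq_j.
  by rewrite eq_j ltnn in lt_j.
- by move=> eq_row; apply: box_content_eq.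
Qed.

Hypothesis lam_n : is_partition n lam.

(** When both inequalities are strict, the comparison passes through the corner box in the row of
    [b] and the column of [c]. *)
Lemma syt_lt T b c : (row_of b <= row_of c)%N -> (col_of b <= col_of c)%N ->
  b != c -> (T b < T c)%N.
Proof.
move=> rbc cbc; case: (ltngtP (row_of b) (row_of c)) rbc => // [rbc|rbc] _;
  case: (ltngtP (col_of b) (col_of c)) cbc => // [cbc|cbc] _ neq_bc.
- have [e [re ce]] := box_above lam_n (ltnW rbc) (leqnn (col_of c)).
  by apply: (@ltn_trans (T e)); [apply: syt_row_lt | apply: syt_col_lt];
    rewrite ?re ?ce.
- exact: syt_col_lt.
- exact: syt_row_lt.
- by rewrite (box_eq rbc cbc) eqxx in neq_bc.
Qed.

(** Inside a row the columns decide the order, in every tableau alike. Together with its analogue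
    for columns, this shows that consecutive entries whose boxes are ordered oppositely in another
    tableau share neither row nor column. *)
Lemma syt_row_order T R b c :
  row_of b = row_of c -> (T b < T c)%N -> (R b < R c)%N.
Proof.
move=> rbc lt_bc; case: (ltngtP (col_of b) (col_of c)) => [|cbc|cbc].
- exact: syt_row_lt.
- by move: (syt_row_lt T (esym rbc) cbc); rewrite ltnNge ltnW.
- by rewrite (box_eq rbc cbc) ltnn in lt_bc.
Qed.

Lemma syt_col_order T R b c :
  col_of b = col_of c -> (T b < T c)%N -> (R b < R c)%N.
Proof.
move=> cbc lt_bc; case: (ltngtP (row_of b) (row_of c)) => [|rbc|rbc].
- exact: syt_col_lt.
- by move: (syt_col_lt T (esym cbc) rbc); rewrite ltnNge ltnW.
- by rewrite (box_eq rbc cbc) ltnn in lt_bc.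
Qed.

Lemma syt_diag_lt T b c :
  content b = content c -> (row_of b < row_of c)%N -> (T b < T c)%N.
Proof.
rewrite /content => cbc rbc; apply: syt_lt; [lia | lia |].
by apply: contraTneq rbc => ->; rewrite ltnn.
Qed.

Lemma syt_content_inj T R :
  (forall j, content (box_at T j) = content (box_at R j)) -> T = R.
Proof.
move=> ctTR; have eqTR : box_at T =1 box_at R.
  apply: (@filling_content_inj T R) => //; [exact: sytK | exact: box_atK
    | exact: sytK | exact: box_atK | move=> b c ctbc rbc].
  by rewrite !syt_diag_lt.
apply/val_inj/ffunP => b /=.
by apply: (can_inj (box_atK R)); rewrite sytK -eqTR sytK.
Qed.

(** * Boxes holding consecutive entries *)

Section Adjacent.
Variables (T : syt n lam) (b c : box lam).
Hypothesis bc_adj : T c = (T b).+1 :> nat.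

Let no_box_between e : (T b < T e)%N -> (T e < T c)%N -> False.
Proof. by rewrite bc_adj; lia. Qed.

Lemma adjacent_neq : b != c.
Proof. by apply/eqP => eq_bc; move: bc_adj; rewrite eq_bc; lia. Qed.

(** If the two boxes were not neighbours, a box between them would need an entry strictly between
    two consecutive integers. *)
Lemma content_same_row : row_of b = row_of c -> content c - content b = 1.
Proof.
move=> rbc; case: (ltngtP (col_of b).+1 (col_of c)) => [lt_bc|gt_bc|eq_bc].
- have [e [re ce]] := box_above lam_n (leqnn (row_of c)) (ltnW lt_bc).
  by case: (@no_box_between e); apply: syt_row_lt; rewrite ?re ?ce.
- have : (T c < T b)%N by apply: syt_lt; rewrite ?rbc // eq_sym adjacent_neq.
  by rewrite bc_adj; lia.
- by rewrite /content rbc; lia.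
Qed.

Lemma content_same_col : col_of b = col_of c -> content c - content b = -1.
Proof.
move=> cbc; case: (ltngtP (row_of b).+1 (row_of c)) => [lt_bc|gt_bc|eq_bc].
- have [e [re ce]] := box_above lam_n (ltnW lt_bc) (leqnn (col_of c)).
  by case: (@no_box_between e); apply: syt_col_lt; rewrite ?re ?ce.
- have : (T c < T b)%N by apply: syt_lt; rewrite ?cbc // eq_sym adjacent_neq.
  by rewrite bc_adj; lia.
- by rewrite /content cbc; lia.
Qed.

(** Neither box can lie to the upper left of the other: [c] has the larger entry, and if [b] were
    strictly above and left of [c], the corner box would need an intermediate entry. So one box is
    strictly above and to the right of the other, and the contents differ by at least 2. *)
Lemma content_skew : row_of b <> row_of c -> col_of b <> col_of c ->
  (content c - content b != 1) && (content c - content b != -1).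
Proof.
move=> rbc cbc; rewrite /content.
have not_cb : ~ ((row_of c <= row_of b)%N /\ (col_of c <= col_of b)%N).
  case=> rcb ccb; have := @syt_lt T c b rcb ccb.
  by rewrite eq_sym adjacent_neq bc_adj => /(_ isT); lia.
have not_bc : ~ ((row_of b < row_of c)%N /\ (col_of b < col_of c)%N).
  case=> rltbc cltbc.
  have [e [re ce]] := box_above lam_n (ltnW rltbc) (leqnn (col_of c)).
  by case: (@no_box_between e);
    [apply: syt_row_lt | apply: syt_col_lt]; rewrite ?re ?ce.
by lia.
Qed.

(** The exchange reverses only the order of the entries in [b] and [c], and standardness does not
    compare boxes sharing neither row nor column. *)
Lemma swap_standard : row_of b <> row_of c -> col_of b <> col_of c ->
  exists T' : syt n lam, forall e, T' e = tperm (T b) (T c) (T e).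
Proof.
move=> rbc cbc; pose F := [ffun e => tperm (T b) (T c) (T e)].
suff F_std : is_standard F by exists (Syt F_std) => e; rewrite ffunE.
have F_lt e e' : (T e < T e')%N -> (e, e') != (b, c) -> (F e < F e')%N.
  move=> Te neq; rewrite !ffunE; apply: tperm_succ_lt => //.
  by rewrite xpair_eqE !(inj_eq (@syt_inj T)) -xpair_eqE.
apply/and4P; split.
- by apply/injectiveP => e e'; rewrite !ffunE => /perm_inj/syt_inj.
- apply/forallP => j; apply/codomP.
  by exists (box_at T (tperm (T b) (T c) j)); rewrite ffunE box_atK tpermK.
- apply/forallP => e; apply/forallP => e'; apply/implyP => /andP[/eqP re ce].
  apply: F_lt; first exact: syt_row_lt.
  by apply/eqP => -[eb ec]; apply: rbc; rewrite -eb -ec.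
- apply/forallP => e; apply/forallP => e'; apply/implyP => /andP[/eqP ce re].
  apply: F_lt; first exact: syt_col_lt.
  by apply/eqP => -[eb ec]; apply: cbc; rewrite -eb -ec.
Qed.

(** The exchanged filling is not assumed standard. It still increases down each diagonal, because
    [b] and [c] lie on different diagonals, and this is all that [filling_content_inj] asks for. *)
Lemma swap_content_inj R : content b != content c ->
    (forall j, content (box_at R j) = content (box_at T (tperm (T b) (T c) j))) ->
  forall e, R e = tperm (T b) (T c) (T e).
Proof.
move=> ctbc ctR e; set s := tperm _ _ in ctR *.
have eqR : box_at R =1 box_at T \o s.
  apply: (@filling_content_inj R (s \o T)) => //.
  - exact: sytK.
  - exact: box_atK.
  - by move=> x /=; rewrite tpermK sytK.
  - by move=> x /=; rewrite box_atK tpermK.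
  - move=> x y ctxy rxy; rewrite syt_diag_lt //=.
    apply: tperm_succ_lt => //; first exact: syt_diag_lt.
    rewrite xpair_eqE !(inj_eq (@syt_inj T)) -xpair_eqE.
    by apply: contraNneq ctbc => -[<- <-]; apply/eqP.
by apply: (can_inj (box_atK R)); rewrite sytK eqR /= tpermK sytK.
Qed.

End Adjacent.

End Tableaux.

(** * Commutation of Jucys-Murphy elements with Coxeter generators *)

Section JucysMurphy.
Variables (F : fieldType) (n d : nat).
Variable rG : mx_representation F [set: 'S_n]%G d.
Implicit Types (g h : 'S_n) (i j : 'I_n).

Lemma reprM g h : rG (g * h)%g = rG g *m rG h.
Proof. by rewrite repr_mxM ?inE. Qed.

Lemma repr_tpermK i j : rG (tperm i j) *m rG (tperm i j) = 1%:M.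
Proof. by rewrite -reprM tperm2 repr_mx1. Qed.

(** Conjugation by s = (i i') carries (k i) to (k i') for k < i; the remaining summand of the
    element at [i'] is s itself, and s s = 1. *)
Lemma jucys_murphy_succ i i' : i' = i.+1 :> nat ->
  rG (tperm i i') *m jucys_murphy rG i =
    jucys_murphy rG i' *m rG (tperm i i') - 1%:M.
Proof.
move=> i'E; set s := tperm i i'.
have -> : jucys_murphy rG i' = rG s + \sum_(k < n | (k < i)%N) rG (tperm k i').
  rewrite /jucys_murphy (bigD1 i) /=; last by rewrite i'E.
  congr (_ + _).
  by apply: eq_bigl => k; rewrite i'E ltnS [in RHS]ltn_neqAle andbC.
rewrite mulmxDl repr_tpermK addrAC subrr add0r mulmx_sumr mulmx_suml.
apply: eq_bigr => k lt_ki; rewrite -!reprM; congr (rG _).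
rewrite conjgCV tpermV tpermJ tpermL tpermD //; rewrite -val_eqE /= ?i'E; lia.
Qed.

Lemma jucys_murphy_pred i i' : i' = i.+1 :> nat ->
  rG (tperm i i') *m jucys_murphy rG i' =
    jucys_murphy rG i *m rG (tperm i i') + 1%:M.
Proof.
move=> i'E; set s := tperm i i'.
rewrite -[jucys_murphy rG i]mul1mx -(repr_tpermK i i').
rewrite -(mulmxA _ _ (jucys_murphy rG i)).
rewrite jucys_murphy_succ // mulmxBr mulmx1 mulmxBl -!mulmxA repr_tpermK mulmx1.
by rewrite subrK.
Qed.

Lemma jucys_murphy_comm i i' j : i' = i.+1 :> nat -> j != i -> j != i' ->
  rG (tperm i i') *m jucys_murphy rG j = jucys_murphy rG j *m rG (tperm i i').
Proof.
move=> i'E ji ji'; rewrite mulmx_sumr mulmx_suml.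
(* Both [i] and [i'] are below [j] or neither is, so the transposition permutes the range of
   summation. *)
rewrite (reindex_inj (@perm_inj _ (tperm i i'))) /=.
apply: eq_big => [k|k lt_kj].
  by case: tpermP => [->|->|//]; move: ji ji'; rewrite -!val_eqE /= i'E; lia.
rewrite -!reprM; congr (rG _).
by rewrite [RHS]conjgC tpermJ [tperm _ _ j]tpermD // eq_sym.
Qed.

End JucysMurphy.

(** * An invariant inner product by averaging *)

Section InvariantForm.
Variables (C : numClosedFieldType) (n d : nat).
Variable rG : mx_representation C [set: 'S_n]%G d.

(** The standard Hermitian product summed over the group; the factor 1/n! is immaterial and
    omitted. *)
Definition average_form (u w : 'rV[C]_d) : C :=
  \sum_(g : 'S_n) \sum_k (u *m rG g) 0 k * ((w *m rG g) 0 k)^*.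

Lemma average_form_bilinear :
  bilinear_for (GRing.Scale.Law.clone _ _ *%R _)
    (GRing.Scale.Law.clone _ _ (conjC \; *%R) _) average_form.
Proof.
split=> [w a u v|u a v w] /=; rewrite /average_form mulr_sumr -big_split /=;
  apply: eq_bigr => g _; rewrite mulr_sumr -big_split /=; apply: eq_bigr => k _.
  by rewrite mulmxDl -scalemxAl !mxE mulrDl mulrA.
by rewrite mulmxDl -scalemxAl !mxE rmorphD rmorphM mulrDr mulrCA.
Qed.

HB.instance Definition _ :=
  bilinear_isBilinear.Build C _ _ _ _ _ average_form average_form_bilinear.

Lemma average_form_hermitian u w :
  average_form u w = (-1) ^+ false * (average_form w u)^*.
Proof.
rewrite expr0 mul1r /average_form rmorph_sum; apply: eq_bigr => g _ /=.
rewrite rmorph_sum; apply: eq_bigr => k _ /=.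
by rewrite rmorphM /= conjCK mulrC.
Qed.

HB.instance Definition _ :=
  isHermitianSesquilinear.Build C _ false conjC average_form average_form_hermitian.

Lemma average_form_gt0 u : u != 0 -> 0 < average_form u u.
Proof.
move=> u_neq0.
have ge0 (v : 'rV[C]_d) : 0 <= \sum_k v 0 k * (v 0 k)^*.
  by apply: sumr_ge0 => k _; apply: mul_conjC_ge0.
rewrite /average_form (bigD1 1%g) //= ltr_wpDr ?sumr_ge0 // repr_mx1 mulmx1.
have /rV0Pn[k uk] : u != 0 by [].
rewrite (bigD1 k) //= ltr_wpDr ?mul_conjC_gt0 //.
by apply: sumr_ge0 => l _; apply: mul_conjC_ge0.
Qed.

HB.instance Definition _ := isDotProduct.Build C _ average_form average_form_gt0.

Lemma average_form_invariant g u w :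
  average_form (u *m rG g) (w *m rG g) = average_form u w.
Proof.
rewrite /average_form [RHS](reindex_inj (mulgI g)) /=; apply: eq_bigr => h _.
by rewrite reprM !mulmxA.
Qed.

Lemma exists_invariant_form : exists B : {dot 'rV[C]_d for conjC},
  forall g u w, B (u *m rG g) (w *m rG g) = B u w.
Proof. by exists average_form; apply: average_form_invariant. Qed.

End InvariantForm.

(** * Orthonormal eigenbases and matrix coefficients *)

Section Eigenbases.
Variables (C : numClosedFieldType) (n d : nat) (lam : seq nat).
Variable rG : mx_representation C [set: 'S_n]%G d.
Variable B : {dot 'rV[C]_d for conjC}.
Hypothesis lam_n : is_partition n lam.
Hypothesis B_inv : forall g u w, B (u *m rG g) (w *m rG g) = B u w.
Implicit Types (T R : syt n lam) (i j : 'I_n) (u w : 'rV[C]_d).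

Lemma dotC u w : B u w = (B w u)^*.
Proof. by rewrite hermC expr0 mul1r. Qed.

Lemma dotZl a u w : B (a *: u) w = a * B u w.
Proof. by rewrite linearZl_LR. Qed.

Lemma dotZr a u w : B u (a *: w) = a^* * B u w.
Proof. by rewrite linearZr_LR. Qed.

Lemma dotDl u v w : B (u + v) w = B u w + B v w.
Proof. exact: linearDl. Qed.

Lemma dotDr u v w : B w (u + v) = B w u + B w v.
Proof. exact: linearDr. Qed.

Lemma dotBl u v w : B (u - v) w = B u w - B v w.
Proof. exact: linearBl. Qed.

Lemma dot_suml (I : finType) (P : pred I) (F : I -> 'rV[C]_d) w :
  B (\sum_(i | P i) F i) w = \sum_(i | P i) B (F i) w.
Proof. exact: linear_sumlz. Qed.

Lemma dot_sumr (I : finType) (P : pred I) (F : I -> 'rV[C]_d) w :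
  B w (\sum_(i | P i) F i) = \sum_(i | P i) B w (F i).
Proof. exact: linear_sumr. Qed.

(** Transpositions are unitary involutions, hence self-adjoint. *)
Lemma dot_tperm i j u w : B (u *m rG (tperm i j)) w = B u (w *m rG (tperm i j)).
Proof. by rewrite -(B_inv (tperm i j)) -mulmxA repr_tpermK mulmx1. Qed.

Lemma dot_jucys_murphy j u w :
  B (u *m jucys_murphy rG j) w = B u (w *m jucys_murphy rG j).
Proof.
rewrite /jucys_murphy !mulmx_sumr dot_suml dot_sumr.
by apply: eq_bigr => k _; rewrite dot_tperm.
Qed.

(** Spanning is recorded as the Fourier expansion, the form in which it is applied. *)
Definition orthonormal_eigenbasis (f : syt n lam -> 'rV[C]_d) : Prop :=
  [/\ forall T R, B (f T) (f R) = (T == R)%:R,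
      forall u, u = \sum_T B u (f T) *: f T
    & forall T j,
        f T *m jucys_murphy rG j = (content (box_at T j))%:~R *: f T].

(** For an orthonormal eigenbasis, this is the coefficient of [f R] in the image of [f T] under
    [g]. *)
Definition coef (f : syt n lam -> 'rV[C]_d) (g : 'S_n) T R : C :=
  B (f T *m rG g) (f R).

Section OneBasis.
Variable f : syt n lam -> 'rV[C]_d.
Hypothesis f_basis : orthonormal_eigenbasis f.

Let f_orth T R : B (f T) (f R) = (T == R)%:R.
Proof. by case: f_basis. Qed.

Let f_exp u : u = \sum_T B u (f T) *: f T.
Proof. by case: f_basis. Qed.

Let f_jm T j : f T *m jucys_murphy rG j = (content (box_at T j))%:~R *: f T.
Proof. by case: f_basis. Qed.

Lemma coef_tperm_conj i j T R : coef f (tperm i j) R T = (coef f (tperm i j) T R)^*.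
Proof. by rewrite /coef dot_tperm dotC. Qed.

Lemma coef_parseval g T : \sum_R coef f g T R * (coef f g T R)^* = 1.
Proof.
have <- : B (f T) (f T) = 1 by rewrite f_orth eqxx.
rewrite -(B_inv g) {2}[f T *m _]f_exp dot_sumr.
by apply: eq_bigr => R _; rewrite dotZr mulrC.
Qed.

(** * The action of one Coxeter generator *)

Section Simple.
Variables (i i' : 'I_n) (T : syt n lam).
Hypothesis i'E : i' = i.+1 :> nat.
Let s := tperm i i'.
Let b := box_at T i.
Let c := box_at T i'.
Let r : C := (content c - content b)%:~R.

Let bc_adj : T c = (T b).+1 :> nat.
Proof. by rewrite !box_atK. Qed.

(** The product <f_T s X_i, f_T> is computed twice, by the relation s X_i = X_(i+1) s - 1 and by
    self-adjointness of X_i. In this multiplied form the identity also yields that [r] is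
    nonzero. *)
Lemma coef_diag : r * coef f s T T = 1.
Proof.
have := dot_jucys_murphy i (f T *m rG s) (f T).
rewrite -mulmxA (jucys_murphy_succ _ i'E) mulmxBr mulmx1 mulmxA !f_jm.
rewrite dotBl -scalemxAl dotZl dotZr rmorph_int f_orth eqxx.
by rewrite /r /coef intrB mulrBl /b /c => <-; rewrite opprB addrC subrK.
Qed.

Lemma coef_diagE : coef f s T T = r^-1.
Proof.
have r_neq0 : r != 0.
  by apply: contra_eq_neq coef_diag => ->; rewrite mul0r eq_sym oner_eq0.
by apply: (mulfI r_neq0); rewrite coef_diag mulfV.
Qed.

Lemma coef_swap R : coef f s T R != 0 -> R != T -> forall e, R e = s (T e).
Proof.
move=> coef_neq0 RT e.
have BTR : B (f T) (f R) = 0 by rewrite f_orth eq_sym (negPf RT).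
(* Self-adjointness of each X_j compares eigenvalues: the content vector of [R] is that of [T] with
   positions [i] and [i'] exchanged. The constant terms of the relations vanish since [f T] and
   [f R] are orthogonal. *)
have eigen j : (content (box_at T (s j)))%:~R * coef f s T R =
    (content (box_at R j))%:~R * coef f s T R.
  have := dot_jucys_murphy j (f T *m rG s) (f R).
  rewrite f_jm dotZr rmorph_int -mulmxA => <-.
  rewrite {1}/s; case: tpermP => [->|->|/eqP ji /eqP ji'].
  - rewrite (jucys_murphy_succ _ i'E) mulmxBr mulmx1 mulmxA f_jm.
    by rewrite dotBl -scalemxAl dotZl BTR subr0.
  - rewrite (jucys_murphy_pred _ i'E) mulmxDr mulmx1 mulmxA f_jm.
    by rewrite dotDl -scalemxAl dotZl BTR addr0.
  - by rewrite (jucys_murphy_comm _ i'E) // mulmxA f_jm -scalemxAl dotZl.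
rewrite /s -(box_atK T i) -(box_atK T i').
apply: (swap_content_inj lam_n) => [//||j].
  apply: contra_eq_neq coef_diag => eq_ct.
  by rewrite /r /b /c eq_ct subrr mul0r eq_sym oner_eq0.
by rewrite !box_atK; apply: (@intr_inj C); apply/esym/(mulIf coef_neq0)/eigen.
Qed.

(* By Parseval nothing is left off f T, its own coefficient having modulus 1. *)
Lemma act_pm1 : r ^+ 2 = 1 -> f T *m rG s = r^-1 *: f T.
Proof.
move=> r21; rewrite [LHS]f_exp (bigD1 T) //= -/(coef f s T T) coef_diagE.
have /eqP := coef_parseval s T; rewrite (bigD1 T) //= coef_diagE.
rewrite fmorphV rmorph_int -invfM -expr2 r21 invr1 addrC -subr_eq0 addrK.
rewrite psumr_eq0 => [/allP coef0|R _]; last exact: mul_conjC_ge0.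
rewrite big1 ?addr0 // => R RT; have := coef0 R (mem_index_enum R).
by rewrite RT mul_conjC_eq0 => /eqP; rewrite /coef => ->; rewrite scale0r.
Qed.

Section Swap.
Variable T' : syt n lam.
Hypothesis T'E : forall e, T' e = s (T e).

Lemma swap_neq : T' != T.
Proof.
apply: contra_eq_neq (T'E b) => ->; rewrite /s box_atK tpermL.
by rewrite -val_eqE /= i'E; lia.
Qed.

Lemma coef_eq0 R : R != T -> R != T' -> coef f s T R = 0.
Proof.
move=> RT RT'; apply: contraNeq RT' => /coef_swap/(_ RT) RE.
by apply/eqP/val_inj/ffunP => e; rewrite /= RE T'E.
Qed.

Lemma act_swap : f T *m rG s = r^-1 *: f T + coef f s T T' *: f T'.
Proof.
rewrite [LHS]f_exp (bigD1 T) //= -/(coef f s T T) coef_diagE.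
rewrite (bigD1 T') ?swap_neq //= big1 ?addr0 // => R /andP[RT RT'].
by rewrite -/(coef f s T R) coef_eq0 ?scale0r.
Qed.

(** Only [T] and [T'] contribute to Parseval's identity, and [T] contributes 1/r^2. *)
Lemma coef_swap_norm : coef f s T T' * (coef f s T T')^* = 1 - r ^- 2.
Proof.
have := coef_parseval s T; rewrite (bigD1 T) //= coef_diagE.
rewrite fmorphV rmorph_int -invfM -expr2 (bigD1 T') ?swap_neq //= big1 ?addr0.
  by move=> <-; rewrite addrAC subrr add0r.
by move=> R /andP[RT RT']; rewrite coef_eq0 ?mul0r.
Qed.

Lemma coef_swap_neq0 : row_of b <> row_of c -> col_of b <> col_of c ->
  coef f s T T' != 0.
Proof.
move=> rbc cbc; rewrite -mul_conjC_eq0 coef_swap_norm subr_eq0 eq_sym.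
rewrite invr_eq1 sqrf_eq1 negb_or.
have /andP[] := content_skew lam_n bc_adj rbc cbc.
by rewrite -2!(eqr_int C) => -> ->.
Qed.

End Swap.

End Simple.

(** * Reaching every tableau from a reference tableau *)

Section Reference.
Variable T0 : syt n lam.

(** Write g = h s with h having one inversion fewer. By induction f_T0 h involves only certain f_Q,
    and s sends f_Q into the span of f_Q and f_(sQ), where sQ has permutation g_Q s. *)
Lemma coef_triangular g R : coef f g T0 R != 0 ->
  syt_perm R T0 = g \/ (#|inversions (syt_perm R T0)| < #|inversions g|)%N.
Proof.
have [m] := ubnP #|inversions g|; elim: m g R => // m IHm g R; rewrite ltnS => le_gm.
have [->|/exists_descent[i [i' [i'E lt_i'i]]]] := eqVneq g 1%g.
  rewrite /coef repr_mx1 mulmx1 f_orth pnatr_eq0 eqb0 negbK => /eqP<-.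
  by left; rewrite syt_perm_id.
pose s := tperm i i'; pose h := (g * s)%g.
have gE : g = (h * s)%g by rewrite /h -mulgA tperm2 mulg1.
have card_g : #|inversions g| = #|inversions h|.+1.
  by rewrite gE (card_inversions_tperm i'E) // invMg tpermV !permM tpermL tpermR.
rewrite /coef {1}gE reprM mulmxA dot_tperm {1}[f R *m _]f_exp dot_sumr => sum_neq0.
have /existsP[Q] : [exists Q, (coef f s R Q != 0) && (coef f h T0 Q != 0)].
  apply: contraNT sum_neq0 => /existsPn coef0; rewrite big1 // => Q _.
  have := coef0 Q; rewrite dotZr negb_and !negbK => /orP[] /eqP; rewrite /coef => ->.
    by rewrite rmorph0 mul0r.
  by rewrite mulr0.
case/andP=> sRQ hQ; have {hQ} IHQ : syt_perm Q T0 = h \/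
    (#|inversions (syt_perm Q T0)| < #|inversions h|)%N.
  by apply: IHm => //; rewrite -card_g.
have [QR|/(coef_swap i'E sRQ) QE] := eqVneq Q R.
  by right; rewrite -QR card_g ltnS; case: IHQ => [->|/ltnW].
have RE e : R e = s (Q e) by rewrite QE tpermK.
rewrite (syt_perm_mul T0 RE); case: IHQ => [->|lt_Qh]; first by left.
right; rewrite card_g ltnS; apply: leq_trans lt_Qh.
(* Multiplication by the simple transposition changes the number of inversions by one, so it adds at
   most one. *)
set q := syt_perm Q T0; case: (ltngtP (q^-1%g i) (q^-1%g i')) => [lt_q|gt_q|eq_q].
- by rewrite (card_inversions_tperm i'E lt_q).
- apply/ltnW/ltnW; rewrite -(card_inversions_tperm i'E).
    by rewrite -mulgA tperm2 mulg1.
  by rewrite invMg tpermV !permM tpermL tpermR.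
- by move/val_inj/perm_inj: eq_q i'E => -> /n_Sn.
Qed.

(** The coefficient q_T from which the phases are built. *)
Definition reach T := coef f (syt_perm T T0) T0 T.

(** Move s across the form and expand f_T' s in f_T' and f_T. The f_T' part drops out by
    triangularity, because g_T' = g_T s has more inversions than g_T. *)
Lemma reach_swap i i' T T' : i' = i.+1 :> nat ->
    (forall e, T' e = tperm i i' (T e)) -> (T0 (box_at T i) < T0 (box_at T i'))%N ->
  reach T' = coef f (tperm i i') T T' * reach T.
Proof.
move=> i'E T'E lt_bc; rewrite -!syt_permV in lt_bc.
have TE e : T e = tperm i i' (T' e) by rewrite T'E tpermK.
have cardT' := card_inversions_tperm i'E lt_bc.
rewrite -(syt_perm_mul T0 T'E) in cardT'.
rewrite /reach {1}/coef (syt_perm_mul T0 T'E) reprM mulmxA dot_tperm.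
rewrite (act_swap i'E TE) dotDr !dotZr -!/(coef _ _ _ _).
have -> : coef f (syt_perm T T0) T0 T' = 0.
  apply: contraTeq isT => /coef_triangular[eqT'|]; last by rewrite cardT'; lia.
  by move: cardT'; rewrite eqT' => /n_Sn.
by rewrite mulr0 add0r -coef_tperm_conj.
Qed.

(** A descent of g_T gives consecutive entries whose boxes are in the opposite order in [T0]. They
    can be exchanged, which lowers the number of inversions and changes q_T only by a nonzero
    factor. *)
Lemma reach_neq0 T : reach T != 0.
Proof.
have [m] := ubnP #|inversions (syt_perm T T0)|; elim: m T => // m IHm T.
rewrite ltnS => le_Tm.
have [/eqP|/exists_descent[i [i' [i'E]]]] := eqVneq (syt_perm T T0) 1%g.
  rewrite -(syt_perm_id T0) => /eqP/syt_perm_inj->.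
  by rewrite /reach /coef syt_perm_id repr_mx1 mulmx1 f_orth eqxx oner_eq0.
rewrite !syt_permV => lt_cb; set b := box_at T i in lt_cb; set c := box_at T i' in lt_cb.
have bc_adj : T c = (T b).+1 :> nat by rewrite !box_atK.
have rbc : row_of b <> row_of c.
  by move=> /(@syt_row_order _ _ T T0); rewrite bc_adj leqnn => /(_ isT); lia.
have cbc : col_of b <> col_of c.
  by move=> /(@syt_col_order _ _ T T0); rewrite bc_adj leqnn => /(_ isT); lia.
have [T' T'E] := swap_standard bc_adj rbc cbc; rewrite !box_atK in T'E.
have TE e : T e = tperm i i' (T' e) by rewrite T'E tpermK.
have T'i : box_at T' i = c.
  by apply: (@syt_inj _ _ T'); rewrite box_atK T'E box_atK tpermR.
have T'i' : box_at T' i' = b.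
  by apply: (@syt_inj _ _ T'); rewrite box_atK T'E box_atK tpermL.
rewrite (reach_swap i'E TE) ?T'i ?T'i' // mulf_neq0 //.
  by rewrite coef_tperm_conj conjC_eq0 coef_swap_neq0.
apply: IHm; apply: leq_trans le_Tm.
rewrite (syt_perm_mul T0 TE) (card_inversions_tperm i'E) //.
by rewrite !syt_permV T'i T'i'.
Qed.

End Reference.
End OneBasis.

(** * Choosing the phases *)

Lemma orthonormal_eigenbasis_scale f (p : syt n lam -> C) :
    (forall T, p T * (p T)^* = 1) -> orthonormal_eigenbasis f ->
  orthonormal_eigenbasis (fun T => p T *: f T).
Proof.
move=> p1 [f_orth f_exp f_jm]; split=> [T R|u|T j].
- rewrite dotZl dotZr f_orth; case: eqP => [->|_]; last by rewrite !mulr0.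
  by rewrite mulr1 p1.
- rewrite [LHS]f_exp; apply: eq_bigr => T _.
  by rewrite dotZr scalerA mulrAC [_^* * _]mulrC p1 mul1r.
- by rewrite -scalemxAl f_jm !scalerA mulrC.
Qed.

(** In the order on [C], being nonnegative includes being real, so the modulus then determines the
    coefficient. *)
Definition positive_swaps (f : syt n lam -> 'rV[C]_d) :=
  forall (T T' : syt n lam) (i i' : 'I_n), i' = i.+1 :> nat ->
    (forall e, T' e = tperm i i' (T e)) -> 0 <= coef f (tperm i i') T T'.

Lemma exists_positive_swaps f : orthonormal_eigenbasis f ->
  exists2 e, orthonormal_eigenbasis e & positive_swaps e.
Proof.
move=> f_basis; case: (pickP (@predT (syt n lam))) => [T0 _|no_syt]; last first.
  by exists f => // T; have := no_syt T.
pose q := reach f T0; pose p T := q T / `|q T|; pose e T := p T *: f T.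
have q_neq0 T : q T != 0 by apply: reach_neq0.
have e_basis : orthonormal_eigenbasis e.
  apply: orthonormal_eigenbasis_scale => // T.
  by rewrite -normCK normrM normfV normr_id divff ?expr1n // normr_eq0.
have coef_e g T R : coef e g T R = p T * (p R)^* * coef f g T R.
  by rewrite /coef /e -scalemxAl dotZl dotZr mulrA.
have up T T' i i' : i' = i.+1 :> nat -> (forall b, T' b = tperm i i' (T b)) ->
    (T0 (box_at T i) < T0 (box_at T i'))%N -> 0 <= coef e (tperm i i') T T'.
  move=> i'E T'E lt_bc; have qT' : q T' = _ := reach_swap f_basis i'E T'E lt_bc.
  have coefE : coef f (tperm i i') T T' = q T' / q T by rewrite qT' mulfK.
  (* Since q_T = p_T |q_T| and p_T has modulus 1, the new coefficient becomes a product of visibly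
     nonnegative factors. *)
  have -> : coef e (tperm i i') T T' = `|q T|^-1 * (p T' * (p T')^* ) * `|q T'|.
    rewrite coef_e coefE {2}/p /p rmorphM fmorphV /= [`|q T'|^*]conj_normC.
    by field; rewrite !normr_eq0 !q_neq0.
  by apply: mulr_ge0 => //; apply: mulr_ge0; rewrite ?invr_ge0 ?mul_conjC_ge0.
exists e => // T T' i i' i'E T'E.
case: (ltngtP (T0 (box_at T i)) (T0 (box_at T i'))) => [|gt_bc|/val_inj/syt_inj eq_bc].
- exact: up.
(* In the opposite order the roles of [T] and [T'] are exchanged, which conjugates the
   coefficient. *)
- rewrite coef_tperm_conj // conjC_ge0; apply: up => // [b|].
    by rewrite T'E tpermK.
  have T'i : box_at T' i = box_at T i'.
    by apply: (@syt_inj _ _ T'); rewrite box_atK T'E box_atK tpermR.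
  have T'i' : box_at T' i' = box_at T i.
    by apply: (@syt_inj _ _ T'); rewrite box_atK T'E box_atK tpermL.
  by rewrite T'i T'i'.
- by move: i'E; rewrite (can_inj (box_atK T) eq_bc) => /n_Sn.
Qed.

(** * Orthonormalizing the given eigenbasis *)

Lemma normalized_eigenbasis (w : syt n lam -> 'rV[C]_d) : is_basis w ->
    (forall T b, w T *m jucys_murphy rG (T b) = (content b)%:~R *: w T) ->
  exists f, orthonormal_eigenbasis f.
Proof.
move=> w_basis w_jm.
have w_jm_at T j : w T *m jucys_murphy rG j = (content (box_at T j))%:~R *: w T.
  by rewrite -w_jm box_atK.
(* If the product is nonzero, self-adjointness equates all the contents of [T] and [R], and the
   content vector determines the tableau. *)
have w_orth T R : T != R -> B (w T) (w R) = 0.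
  apply: contra_neq_eq => BTR; apply: (syt_content_inj lam_n) => j.
  apply: (@intr_inj C); apply: (mulIf BTR).
  have := dot_jucys_murphy j (w T) (w R).
  by rewrite !w_jm_at dotZl dotZr rmorph_int.
pose N T := sqrtC (B (w T) (w T)).
have N_gt0 T : 0 < N T.
  rewrite sqrt_dnorm_gt0; apply: (free_not0 (basis_free w_basis)).
  exact: codom_f.
have N_conj T : (N T)^* = N T by apply/conj_Creal/gtr0_real.
have N2 T : N T * N T = B (w T) (w T) by rewrite -expr2 sqrtCK.
exists (fun T => (N T)^-1 *: w T); split=> [T R|u|T j].
- rewrite dotZl dotZr fmorphV /= N_conj; have [->|TR] := eqVneq T R.
    by rewrite -N2 /=; field; rewrite gt_eqF.
  by rewrite w_orth // !mulr0.
- have [a ->] : exists a : syt n lam -> C, u = \sum_T a T *: w T.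
    have : u \in <<codom w>>%VS by rewrite (span_basis w_basis) memvf.
    rewrite /codom /image_mem span_def big_map big_enum /=.
    case/memv_sumP=> v v_line ->.
    have /fin_all_exists[a aE] T : exists c, v T = c *: w T.
      by apply/vlineP/v_line.
    by exists a; apply: eq_bigr => T _.
  apply: eq_bigr => T _; rewrite dotZr dot_suml fmorphV /= N_conj (bigD1 T) //=.
  rewrite big1 => [|R RT]; last by rewrite dotZl w_orth ?mulr0.
  rewrite addr0 dotZl scalerA -N2; congr (_ *: _); field.
  by rewrite gt_eqF.
- by rewrite -scalemxAl w_jm_at !scalerA mulrC.
Qed.

(** The family spans by its expansion formula, and it has as many members as the basis [w]. *)
Lemma orthonormal_eigenbasis_is_basis (w f : syt n lam -> 'rV[C]_d) :
  is_basis w -> orthonormal_eigenbasis f -> is_basis f.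
Proof.
move=> w_basis [_ f_exp _]; rewrite /is_basis basisEdim; apply/andP; split.
  apply/subvP => u _; rewrite [u]f_exp; apply: memv_suml => T _.
  by apply/memvZ/memv_span/codom_f.
by rewrite (size_basis w_basis) size_codom.
Qed.

End Eigenbases.

(** * Young's orthogonal form *)

Theorem proposition6p2 (R : realType) (n : nat) (lam : seq nat)
    (lam_n : is_partition n lam)
    (d : nat) (rG : mx_representation R[i] [set: 'S_n]%G d)
    (V_lam : is_irr_module rG lam) :
  exists (B : {dot 'rV[R[i]]_d for conjC}) (v : syt n lam -> 'rV[R[i]]_d),
    [/\ invariant_form rG B,
        is_basis v,
        forall T U : syt n lam, T != U -> B (v T) (v U) = 0
      & forall (T : syt n lam) (b b' : box lam), T b' = (T b).+1 :> nat ->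
        let s := rG (tperm (T b) (T b')) in
        [/\ row_of b = row_of b' -> v T *m s = v T,
            col_of b = col_of b' -> v T *m s = - v T
          & row_of b <> row_of b' -> col_of b <> col_of b' ->
            let r : R[i] := (content b' - content b)%:~R in
            exists T' : syt n lam,
              [/\ forall c : box lam, T' c = tperm (T b) (T b') (T c),
                  v T *m s = r^-1 *: v T + sqrtC (1 - r ^- 2) *: v T'
                & v T' *m s = sqrtC (1 - r ^- 2) *: v T - r^-1 *: v T']]].
Proof.
case: V_lam => _ [w [w_basis w_jm]].
have [B B_inv] := exists_invariant_form rG.
have [f f_basis] := normalized_eigenbasis lam_n B_inv w_basis w_jm.
have [v v_basis v_pos] := exists_positive_swaps lam_n B_inv f_basis.
exists B, v; split=> //.
- exact: orthonormal_eigenbasis_is_basis w_basis v_basis.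
- by case: v_basis => v_orth _ _ T U TU; rewrite v_orth (negPf TU).
move=> T b b' bb'_adj /=; split=> [rbb'|cbb'|rbb' cbb'].
- have := act_pm1 B_inv v_basis (T := T) bb'_adj.
  rewrite !sytK (content_same_row lam_n bb'_adj rbb') expr1n => ->//.
  by rewrite invr1 scale1r.
- have := act_pm1 B_inv v_basis (T := T) bb'_adj.
  rewrite !sytK (content_same_col lam_n bb'_adj cbb') rmorphN1 sqrrN expr1n => ->//.
  by rewrite invrN invr1 scaleN1r.
have [T' T'E] := swap_standard bb'_adj rbb' cbb'; exists T'.
have TE e : T e = tperm (T b) (T b') (T' e) by rewrite T'E tpermK.
have T'b : box_at T' (T b) = b'.
  by apply: (@syt_inj _ _ T'); rewrite box_atK T'E tpermR.
have T'b' : box_at T' (T b') = b.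
  by apply: (@syt_inj _ _ T'); rewrite box_atK T'E tpermL.
(* The coefficient is nonnegative and its square is 1 - 1/r^2, so it is the chosen square root. *)
have coef_sqrt : coef rG B v (tperm (T b) (T b')) T T' =
    sqrtC (1 - (content b' - content b)%:~R ^- 2).
  have c_ge0 := v_pos _ _ _ _ bb'_adj T'E.
  have := coef_swap_norm lam_n B_inv v_basis bb'_adj T'E.
  by rewrite conj_Creal ?ger0_real // -expr2 !sytK => <-; rewrite sqrCK.
split=> //.
- by rewrite (act_swap lam_n B_inv v_basis bb'_adj T'E) !sytK coef_sqrt.
(* The same formula with [T] and [T'] exchanged: the content difference changes sign, and the real
   off-diagonal coefficient stays the same. *)
- rewrite (act_swap lam_n B_inv v_basis bb'_adj TE) T'b T'b' addrC.
  rewrite (coef_tperm_conj B_inv) coef_sqrt conj_Creal ?ger0_real -?coef_sqrt ?v_pos //.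
  by rewrite -[content b - _]opprB intrN invrN scaleNr.
Qed.
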